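(* Let $0<p<1$, let $L\ge 1$ be an integer, and let $R$ be a real number with $$R < 1 - \left(1 + \frac{1}{L}\right)\left(H(p) + p \log 3\right).$$ Then for all sufficiently large $n$ there exists an $[n,\lfloor Rn\rfloor,\lfloor pn\rfloor,L]$-list code.
   Context: Logarithms are base 2 and $H(p)=-p\log p-(1-p)\log(1-p)$ is the binary entropy. $\mathcal{G}_n$ denotes the $n$-qubit Pauli group, with elements $i^t X^{\mathbf u}Z^{\mathbf v}$ ($t\in\{0,1,2,3\}$, $\mathbf u,\mathbf v\in\{0,1\}^n$, $X^{\mathbf u}=X^{u_1}\otimes\cdots\otimes X^{u_n}$, similarly for $Z$). The weight $\mathrm{wt}(P)$ of a Pauli operator is the number of qubits on which it acts nontrivially, and for a real $r>0$, $\mathcal{E}^r$ is the set of Pauli operators of weight at most $\lfloor r\rfloor$. An $[n,k]$ stabilizer code is the $2^k$-dimensional subspace of $n$-qubit states fixed by every element of an abelian subgroup $S\le\mathcal{G}_n$ of size $2^{n-k}$ (not containing $-I$), generated by $n-k$ independent generators $S_1,\dots,S_{n-k}$; the syndrome of $E\in\mathcal G_n$ is the bit string $(\omega(E,S_i))_{i=1}^{n-k}$, where $P_1P_2=(-1)^{\omega(P_1,P_2)}P_2P_1$. For a $k$-qubit state $|\psi\rangle$, $|\bar\psi\rangle$ denotes its encoding into the code. An $[n,k]$ stabilizer code $\mathcal C$ is an $[n,k,t,L]$-list code if there is a decoding operation (quantum channel) $\mathcal D$ such that for every $E\in\mathcal{E}^{t}$ and every encoded state $|\bar\psi\rangle\in\mathcal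 C$, the decoded $k$-qubit state together with the syndrome $s$ is $\mathcal D(E|\bar\psi\rangle\langle\bar\psi|E^\dagger)=\sum_s\sum_j A^s_j|\psi\rangle\langle\psi|A^{s\dagger}_j\otimes|s\rangle\langle s|$, where $\sum_{s,j}A^{s\dagger}_jA^s_j=I$ and each $A^s_j$ is a linear combination of the $2^L$ elements of the group $\langle P^s_l\rangle_{l=1}^L$ generated by a list $\{P^s_l\}_{l=1}^L$ of logical (Pauli) errors on the code space (the list may depend on $s$). *)

(* Defs.v *)
From HB Require Import structures.
From mathcomp Require Import all_boot all_order all_algebra.
From mathcomp Require Import complex mxtens.
From mathcomp Require Import reals exp.

Set Implicit Arguments.
Unset Strict Implicit.
Unset Printing Implicit Defensive.

Import Order.TTheory GRing.Theory Num.Theory.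
Local Open Scope ring_scope.

Section Quantum.
Variable R : realType.
Local Notation C := R[i].

Definition log2 (x : R) : R := ln x / ln 2.
Definition Hbin (p : R) : R := - p * log2 p - (1 - p) * log2 (1 - p).

(* Computational basis of n qubits: bit strings x : 'I_n -> bool.
   The state space is C^(2^n), represented with index type 'I_(dim n),
   where dim n = #|bits n| = 2^n and the basis vector |x> has index enum_rank x. *)
Definition bits (n : nat) := {ffun 'I_n -> bool}.
Definition dim (n : nat) : nat := #|{: bits n}|.
Definition ket_idx n (x : bits n) : 'I_(dim n) := enum_rank x.
Definition bit_of n (i : 'I_(dim n)) : bits n := enum_val i.

Definition adj m n (A : 'M[C]_(m, n)) : 'M[C]_(n, m) := (map_mx (@conjc R) A)^T.

(* The Pauli operator i^t X^u Z^v. *)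
Record pauli (n : nat) := Pauli { pphase : 'I_4; pX : bits n; pZ : bits n }.

Definition bxor n (x y : bits n) : bits n := [ffun k => xorb (x k) (y k)].

(* X^u Z^v |x> = (-1)^(v.x) |x + u> *)
Definition pauli_mx n (P : pauli n) : 'M[C]_(dim n) :=
  \matrix_(i, j)
    ((('i : C) ^+ pphase P) *
     (if bit_of i == bxor (bit_of j) (pX P)
      then (-1) ^+ #|[set k | pZ P k && bit_of j k]| else 0)).

Definition weight n (P : pauli n) : nat := #|[set k | pX P k || pZ P k]|.

(* omega(P1,P2) : P1 P2 = (-1)^omega P2 P1 ; omega = 1 iff they do not commute *)
Definition omega n (P1 P2 : pauli n) : bool :=
  pauli_mx P1 *m pauli_mx P2 != pauli_mx P2 *m pauli_mx P1.

(* group generated by the operators S_1..S_m (a finite group, so finite products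
   suffice) *)
Definition in_group n m (S : 'I_m -> pauli n) (M : 'M[C]_(dim n)) : Prop :=
  exists s : seq 'I_m, M = \prod_(j <- s) pauli_mx (S j).

Definition stabilizer_generators n m (S : 'I_m -> pauli n) : Prop :=
  [/\ (forall i j, pauli_mx (S i) *m pauli_mx (S j) = pauli_mx (S j) *m pauli_mx (S i)),
      ~ in_group S (- 1%:M)
    & (forall j, ~ exists s : seq 'I_m,
          all (fun i => i != j) s /\ pauli_mx (S j) = \prod_(i <- s) pauli_mx (S i))].

Definition in_code n m (S : 'I_m -> pauli n) (psi : 'cV[C]_(dim n)) : Prop :=
  forall M, in_group S M -> M *m psi = psi.

Definition encoding n m k (S : 'I_m -> pauli n) (Enc : 'M[C]_(dim n, dim k)) : Prop :=
  adj Enc *m Enc = 1%:M /\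
  (forall psi, in_code S psi <-> exists phi : 'cV[C]_(dim k), psi = Enc *m phi).

Definition syndrome n m (S : 'I_m -> pauli n) (E : pauli n) : bits m :=
  [ffun i => omega E (S i)].

Definition trace_preserving din dout J (K : 'I_J -> 'M[C]_(dout, din)) : Prop :=
  \sum_(j < J) adj (K j) *m K j = 1%:M.

Definition apply_channel din dout J (K : 'I_J -> 'M[C]_(dout, din))
  (rho : 'M[C]_din) : 'M[C]_dout :=
  \sum_(j < J) K j *m rho *m adj (K j).

(* A is a linear combination of the 2^L elements of the group generated by
   P_1..P_L (taken up to phase: the products over subsets) *)
Definition in_list_span k L (P : 'I_L -> pauli k) (A : 'M[C]_(dim k)) : Prop :=
  exists c : bits L -> C,
    A = \sum_(b : bits L) c b *: \prod_(l < L | b l) pauli_mx (P l).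

Definition proj_syn m (s : bits m) : 'M[C]_(dim m) := delta_mx (ket_idx s) (ket_idx s).

Definition list_code (n k t L : nat) : Prop :=
  (k <= n)%N /\
  exists S : 'I_(n - k) -> pauli n,
  stabilizer_generators S /\
  exists Enc : 'M[C]_(dim n, dim k),
  encoding S Enc /\
  (* decoding channel: n qubits -> (k qubits) (x) (syndrome register) *)
  exists (J : nat) (D : 'I_J -> 'M[C]_(dim k * dim (n - k), dim n)),
  trace_preserving D /\
  exists P : bits (n - k) -> 'I_L -> pauli k,
  forall E : pauli n, (weight E <= t)%N ->
  exists (J' : nat) (A : bits (n - k) -> 'I_J' -> 'M[C]_(dim k)),
    \sum_(s : bits (n - k)) \sum_(j < J') adj (A s j) *m A s j = 1%:M /\
    (forall s j, in_list_span (P s) (A s j)) /\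
    forall phi : 'cV[C]_(dim k), adj phi *m phi = 1%:M ->
      let psi := pauli_mx E *m (Enc *m phi) in
      apply_channel D (psi *m adj psi) =
      \sum_(s : bits (n - k)) \sum_(j < J')
         ((A s j *m (phi *m adj phi) *m adj (A s j)) *t proj_syn s).

End Quantum.

(* Main.v *)
Require Import Defs.
From HB Require Import structures.
From mathcomp Require Import all_boot all_order all_algebra.
From mathcomp Require Import complex mxtens.
From mathcomp Require Import zify ring lra.
From mathcomp Require Import reals exp.
Import Order.TTheory GRing.Theory Num.Theory.
Local Open Scope ring_scope.

(** Pauli operators modulo phase form the symplectic space F_2^(2n). A stabilizer
    code with m = n - k generators is the image of the standard code (the first m
    qubits are [|0>]) under a Clifford unitary, and products of the unitaries
    (1 + i P) / sqrt 2, P a Hermitian Pauli operator, already give enough of them: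
    they act as symplectic transvections. Pulled back by the unitary, an error flips
    the first m qubits by its syndrome s and acts as a Pauli operator on the other k
    qubits, so the decoder just undoes the unitary, and the list for s has to span
    the logical parts of the low-weight errors with syndrome s.

    This fails only if some L + 1 low-weight errors have equal syndromes and logical
    parts whose L differences are independent. The generators are chosen greedily:
    a random admissible generator commutes with L given independent differences with
    probability about 2^-L, so some choice divides the number of surviving bad
    (L+1)-tuples by about 2^L. After m steps fewer than 2 |B|^(L+1) / 2^(L m) remain,
    where B is the ball of errors of weight at most p n. As |B| <= 2^(n (H(p) + p log 3)),
    this is less than one for large n. *)

Set Implicit Arguments.
Unset Strict Implicit.
Unset Printing Implicit Defensive.

Local Notation dim := Defs.dim.

(** * Subset sums and symplectic transvections *)

Section SubsetSums.
Variable V : zmodType.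
Hypothesis addv_self : forall v : V, v + v = 0.

Definition subsum r (d : 'I_r -> V) (b : bits r) : V := \sum_(i | b i) d i.

Definition ocons T r (x : T) (d : 'I_r -> T) (i : 'I_r.+1) : T :=
  if unlift ord0 i is Some k then d k else x.

Lemma ocons0 T r (x : T) (d : 'I_r -> T) : ocons x d ord0 = x.
Proof. by rewrite /ocons unlift_none. Qed.

Lemma oconsS T r (x : T) (d : 'I_r -> T) k : ocons x d (lift ord0 k) = d k.
Proof. by rewrite /ocons liftK. Qed.

Lemma subsum_recl r (d : 'I_r.+1 -> V) (b : bits r.+1) :
  subsum d b = (if b ord0 then d ord0 else 0) +
    subsum (fun k => d (lift ord0 k)) [ffun k => b (lift ord0 k)].
Proof.
rewrite /subsum big_mkcond big_ord_recl; congr (_ + _).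
by rewrite [RHS]big_mkcond; apply: eq_bigr => k _; rewrite ffunE.
Qed.

Lemma subsum_ocons r (y : V) (d : 'I_r -> V) (c : bool) (b : bits r) :
  subsum (ocons y d) [ffun i => ocons c b i] = (if c then y else 0) + subsum d b.
Proof.
rewrite subsum_recl ffunE !ocons0 /subsum; congr (_ + _).
apply: eq_big => [k|k _]; last by rewrite oconsS.
by rewrite !ffunE oconsS.
Qed.

Lemma bits_ocons r (b : bits r.+1) :
  b = [ffun i => ocons (b ord0) [ffun k => b (lift ord0 k)] i].
Proof.
apply/ffunP => i; rewrite ffunE /ocons.
by case: unliftP => [k ->|->]; rewrite ?ffunE.
Qed.

Definition spans r (d : 'I_r -> V) (y : V) := [exists b : bits r, y == subsum d b].

(** An independent family drawn from [Y] that does not span [Y] can be extended by any unspanned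
    vector [y]: a relation involving [y] would make [y] a subset sum of the family. *)
Lemma spanned_or_independent (Y : seq V) (r : nat) :
  (exists d : 'I_r -> V, all (spans d) Y) \/
  (exists2 d : 'I_r.+1 -> V, forall i, d i \in Y &
     forall b, subsum d b = 0 -> b = 0).
Proof.
elim: r => [|r IHr].
  have [/allP Y0|/allPn[y Yy y0]] := boolP (all (pred1 0) Y); [left|right].
    exists (fun=> 0); apply/allP => y /Y0 /eqP ->.
    by apply/existsP; exists 0; rewrite /subsum big1.
  exists (fun=> y) => // b; rewrite /subsum big_mkcond big_ord1.
  case E: (b ord0); first by move/eqP => y0'; case/negP: y0.
  by move=> _; apply/ffunP => i; rewrite ord1 E ffunE.
case: IHr => [[d /allP dY]|[d dY dI]].
  left; exists (ocons 0 d); apply/allP => y /dY /existsP[b /eqP ->].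
  apply/existsP; exists [ffun i => ocons false b i].
  by rewrite subsum_ocons add0r.
have [YS|/allPn[y Yy yS]] := boolP (all (spans d) Y); [by left; exists d|right].
exists (ocons y d) => [i|b].
  by rewrite /ocons; case: unliftP.
rewrite (bits_ocons b) subsum_ocons; set b' := [ffun k => _].
case: (b ord0) => [/eqP|].
  rewrite addr_eq0 => /eqP yb; case/negP: yS; apply/existsP; exists b'.
  by rewrite yb; apply/eqP/eqP; rewrite eq_sym -subr_eq0 opprK addv_self.
rewrite add0r => /dI ->; apply/ffunP => i; rewrite !ffunE /ocons.
by case: unliftP => [k _|//]; rewrite ffunE.
Qed.

(* An affinely [L]-dependent family lies in an affine space of dimension less
   than [L], hence in a linear span of [L] vectors. *)
Lemma span_of_affine_dependent (X : seq V) (L : nat) : (0 < L)%N ->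
  (forall f : 'I_L.+1 -> V, (forall i, f i \in X) ->
     exists2 b : bits L, b != 0 &
       subsum (fun i => f (lift ord0 i) + f ord0) b = 0) ->
  exists d : 'I_L -> V, forall x, x \in X -> exists b, x = subsum d b.
Proof.
case: L => // r _ XL.
case: X XL => [_|x0 X XL]; first by exists (fun=> 0).
(* Here [L] is [r + 1]: [r] vectors spanning the differences from the base point [x0], together with
   [x0], span the whole set. *)
case: (spanned_or_independent [seq x + x0 | x <- x0 :: X] r) => [[d /allP dX]|].
  exists (ocons x0 d) => x xX.
  have /existsP[b /eqP xb] := dX _ (map_f (fun x => x + x0) xX).
  exists [ffun i => ocons true b i].
  by rewrite subsum_ocons -xb addrCA addv_self addr0.
move=> [d dX dI].
have XLd := XL (ocons x0 (fun i => d i + x0)).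
case: XLd => [i|b b0].
  rewrite /ocons; case: unliftP => [k _|_]; last exact: mem_head.
  by have /mapP[x xX ->] := dX k; rewrite -addrA addv_self addr0.
rewrite /subsum.
under eq_bigr do rewrite oconsS ocons0 -addrA addv_self addr0.
by move/dI => b0'; rewrite b0' eqxx in b0.
Qed.

End SubsetSums.

Section Symplectic.
Variable n : nat.
Local Notation V := (bits n * bits n)%type.
Implicit Types (x y : bits n) (a b w : V).

Lemma addbits_self x : x + x = 0.
Proof. by apply/ffunP => i; rewrite !ffunE; case: (x i). Qed.

Lemma addv_self a : a + a = 0.
Proof. by case: a => x y; rewrite /GRing.add /= /add_pair /= !addbits_self. Qed.

Lemma addv_selfK a b : a + b + b = a.
Proof. by rewrite -addrA addv_self addr0. Qed.

(** [bool] serves as the field F_2: its addition is exclusive or. *)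
Definition dotb x y : bool := \sum_i x i * y i.

Lemma dotbDl x x' y : dotb (x + x') y = dotb x y + dotb x' y.
Proof. by rewrite -big_split; apply: eq_bigr => i _; rewrite ffunE mulrDl. Qed.

Lemma dotbC x y : dotb x y = dotb y x.
Proof. by apply: eq_bigr => i _; rewrite mulrC. Qed.

Lemma dotbDr x y y' : dotb x (y + y') = dotb x y + dotb x y'.
Proof. by rewrite dotbC dotbDl !(dotbC x). Qed.

Lemma dotb0 x : dotb x 0 = 0.
Proof. by apply: big1 => i _; rewrite ffunE mulr0. Qed.

Lemma dot0b x : dotb 0 x = 0.
Proof. by rewrite dotbC dotb0. Qed.

Definition ebit (i : 'I_n) : bits n := [ffun k => k == i].

Lemma dotb_ebit x i : dotb x (ebit i) = x i.
Proof.
rewrite /dotb (bigD1 i) //= ffunE eqxx mulr1 big1 ?addr0 // => k ki.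
by rewrite ffunE (negPf ki) mulr0.
Qed.

(** By [weylC], this form records whether the two Pauli operators anticommute. *)
Definition sympl a b : bool := dotb a.1 b.2 + dotb a.2 b.1.

Lemma symplDl a a' b : sympl (a + a') b = sympl a b + sympl a' b.
Proof. by rewrite /sympl !dotbDl addrACA. Qed.

Lemma symplC a b : sympl a b = sympl b a.
Proof. by rewrite /sympl addrC dotbC (dotbC a.1). Qed.

Lemma symplDr a b b' : sympl a (b + b') = sympl a b + sympl a b'.
Proof. by rewrite symplC symplDl !(symplC a). Qed.

Lemma sympl_self a : sympl a a = false.
Proof. by rewrite /sympl dotbC; case: (dotb _ _). Qed.

Lemma sympl0 a : sympl a 0 = false.
Proof. by rewrite /sympl !dotb0. Qed.

Definition ex i : V := (ebit i, 0).
Definition ez i : V := (0, ebit i).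

Lemma sympl_ez a i : sympl a (ez i) = a.1 i.
Proof. by rewrite /sympl /= dotb_ebit dotb0 addr0. Qed.

Lemma sympl_ex a i : sympl a (ex i) = a.2 i.
Proof. by rewrite /sympl /= dotb_ebit dotb0 add0r. Qed.

Definition transv w a : V := if sympl a w then a + w else a.

Lemma transvD w a b : transv w (a + b) = transv w a + transv w b.
Proof.
rewrite /transv symplDl; case: (sympl a w); case: (sympl b w) => //=.
- by rewrite addrACA addv_self addr0.
- by rewrite addrAC.
- by rewrite addrA.
Qed.

Lemma sympl_transv w a b : sympl (transv w a) (transv w b) = sympl a b.
Proof.
rewrite /transv; case E: (sympl a w); case F: (sympl b w) => //=;
  by rewrite ?symplDl ?symplDr ?sympl_self ?(symplC w) ?E ?F;
     case: (sympl a b).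
Qed.

Lemma transvK w : involutive (transv w).
Proof.
move=> a; rewrite /transv; case E: (sympl a w); last by rewrite E.
by rewrite symplDl sympl_self E /= addv_selfK.
Qed.

Lemma transv_pair a b : sympl a b -> transv (a + b) a = b.
Proof.
by move=> ab; rewrite /transv symplDr sympl_self ab /= addrA addv_self add0r.
Qed.

Definition transvs (ws : seq V) a : V := foldr transv a ws.

Lemma transvsD ws a b : transvs ws (a + b) = transvs ws a + transvs ws b.
Proof. by elim: ws => //= w ws ->; rewrite transvD. Qed.

Lemma sympl_transvs ws a b : sympl (transvs ws a) (transvs ws b) = sympl a b.
Proof. by elim: ws => //= w ws <-; rewrite sympl_transv. Qed.

Lemma transvs0 ws : transvs ws 0 = 0.
Proof. by elim: ws => //= w ws ->; rewrite /transv symplC sympl0. Qed.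

Lemma transvs_cat us ws a : transvs (us ++ ws) a = transvs us (transvs ws a).
Proof. by rewrite /transvs foldr_cat. Qed.

Lemma transvs_sum ws (I : finType) (P : pred I) (d : I -> V) :
  transvs ws (\sum_(i | P i) d i) = \sum_(i | P i) transvs ws (d i).
Proof. by apply: big_morph; [exact: transvsD | exact: transvs0]. Qed.

Lemma transvs_revK ws : cancel (transvs (rev ws)) (transvs ws).
Proof.
elim: ws => // w ws IH a.
by rewrite rev_cons -cats1 transvs_cat /= IH transvK.
Qed.

(* [spanZ j] is the span of the [ez i], [i < j], and [perpZ j] its orthogonal
   complement for [sympl]. *)
Definition perpZ (j : nat) : {set V} :=
  [set a : V | [forall i : 'I_n, (i < j)%N ==> ~~ a.1 i]].
Definition spanZ (j : nat) : {set V} :=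
  [set a : V | (a.1 == 0) && [forall i : 'I_n, (j <= i)%N ==> ~~ a.2 i]].

Lemma perpZP j a :
  reflect (forall i : 'I_n, (i < j)%N -> a.1 i = false) (a \in perpZ j).
Proof.
rewrite inE; apply: (iffP forallP) => H i.
  by move=> ij; apply: negbTE; apply: (implyP (H i)).
by apply/implyP => /H ->.
Qed.

Lemma perpZD j a b : a \in perpZ j -> b \in perpZ j -> a + b \in perpZ j.
Proof.
move=> /perpZP Ha /perpZP Hb; apply/perpZP => i ij.
by rewrite ffunE Ha ?Hb.
Qed.

Lemma ez_perpZ j i : ez i \in perpZ j.
Proof. by apply/perpZP => k _; rewrite ffunE. Qed.

Lemma ex_perpZ j (i : 'I_n) : (j <= i)%N -> ex i \in perpZ j.
Proof.
move=> ji; apply/perpZP => k kj; rewrite ffunE.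
by apply/eqP => ki; rewrite ki in kj; lia.
Qed.

Lemma spanZ_witness j a : a \in perpZ j -> a \notin spanZ j ->
  exists i : 'I_n, (j <= i)%N && (a.1 i || a.2 i).
Proof.
move=> /perpZP Ha; rewrite inE negb_and => /orP[a1|].
  have [i ai|a0] := pickP (fun i => a.1 i); last first.
    by case/negP: a1; apply/eqP/ffunP => i; rewrite a0 ffunE.
  exists i; rewrite ai andbT leqNgt; apply/negP => /Ha.
  by rewrite ai.
rewrite negb_forall => /existsP[l]; rewrite negb_imply negbK => /andP[jl al].
by exists l; rewrite jl al orbT.
Qed.

(** [spanZ j] is the radical of the form on [perpZ j]: outside it, some coordinate at a qubit
    [i >= j] is nonzero, and [ez i] or [ex i] detects it. *)
Lemma sympl_nondegenerate j a : a \in perpZ j -> a \notin spanZ j ->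
  exists2 w, w \in perpZ j & sympl a w.
Proof.
move=> Ha /(spanZ_witness Ha)[i /andP[ji /orP[ai|ai]]].
  by exists (ez i); [exact: ez_perpZ | rewrite sympl_ez].
by exists (ex i); [exact: ex_perpZ | rewrite sympl_ex].
Qed.

Lemma transv_ez j w (i : 'I_n) : w \in perpZ j -> (i < j)%N ->
  transv w (ez i) = ez i.
Proof. by move=> /perpZP Hw ij; rewrite /transv symplC sympl_ez Hw. Qed.

(** This lets any admissible [w] become the next generator. The transvection along [a + b] swaps
    anticommuting [a] and [b]; all those used are along vectors of [perpZ j], so the earlier [ez i]
    stay fixed. *)
Lemma transvs_transitive (j : 'I_n) w : w \in perpZ j -> w \notin spanZ j ->
  exists us, (forall i : 'I_n, (i < j)%N -> transvs us (ez i) = ez i) /\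
             transvs us w = ez j.
Proof.
move=> Hw Hw'.
case wj: (sympl w (ez j)).
  exists [:: w + ez j]; split=> [i ij|] /=; last exact: transv_pair.
  by apply: (@transv_ez j) => //; rewrite perpZD ?ez_perpZ.
(* When [w] and [ez j] commute, two transvections go from [w] to [ez j] through a [y] anticommuting
   with both. *)
suff [y Hy [yj yw]] : exists2 y, y \in perpZ j & sympl y (ez j) /\ sympl y w.
  exists [:: y + ez j; w + y]; split=> [i ij|] /=.
    by rewrite !(@transv_ez j) ?perpZD ?ez_perpZ.
  by rewrite (transv_pair (a := w)) ?transv_pair // symplC.
case w2j: (w.2 j).
  exists (ex j); first exact: ex_perpZ.
  by rewrite sympl_ez /= ffunE eqxx symplC sympl_ex.
(* Now [w] is trivial at qubit [j]. There [ex j] anticommutes with [ez j] but not with [w]; adding a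
   [y] with the opposite behaviour repairs this. *)
suff [y Hy [yj yw]] : exists2 y, y \in perpZ j & sympl y (ez j) = false /\ sympl y w.
  exists (ex j + y); first by rewrite perpZD ?ex_perpZ.
  rewrite !symplDl yj yw (symplC (ex j) w) sympl_ex w2j sympl_ez /=.
  by rewrite ffunE eqxx.
rewrite sympl_ez in wj.
have [i /andP[ji /orP[wi|wi]]] := spanZ_witness Hw Hw'.
  exists (ez i); first exact: ez_perpZ.
  by rewrite sympl_ez symplC sympl_ez ffunE.
exists (ex i); first exact: ex_perpZ.
rewrite sympl_ez symplC sympl_ex wi /= ffunE; split=> //.
by apply/eqP => ij; rewrite ij wi in w2j.
Qed.

End Symplectic.

(** * Greedy choice of the generators *)

Lemma exists_le_average (T : finType) (A : {set T}) (F : T -> nat) (M : nat) w0 :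
  w0 \in A -> (\sum_(w in A) F w <= M)%N -> exists2 w, w \in A & (F w * #|A| <= M)%N.
Proof.
move=> w0A FM; case: (@arg_minnP _ w0 (mem A) F w0A) => w wA wmin.
exists w => //; apply: leq_trans FM; rewrite mulnC -sum_nat_const.
by apply: leq_sum => v vA; apply: wmin.
Qed.

Lemma card_bits_supported n (P : pred 'I_n) :
  #|[set x : bits n | [forall i, ~~ P i ==> ~~ x i]]| = (2 ^ #|P|)%N.
Proof.
rewrite -card_bool -(card_pffun_on false P predT) cardsE; apply: eq_card => x.
rewrite unfold_in; apply/forallP/pffun_onP => [H|[/subsetP H _] i].
  split=> //; apply/subsetP => i; rewrite inE => xi.
  by rewrite unfold_in; move: (H i) xi; case: (P i); case: (x i).
by apply/implyP => Pi; apply: contra Pi => xi; apply: H; rewrite inE xi.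
Qed.

Lemma card_ord_ltn n j : (#|[pred i : 'I_n | (i < j)%N]| <= j)%N.
Proof.
rewrite cardE -(size_map val) -[leqRHS](size_iota 0 j).
apply: uniq_leq_size; first by rewrite map_inj_uniq ?enum_uniq //; apply: val_inj.
move=> k /mapP[l]; rewrite mem_enum inE => lj ->.
by rewrite mem_iota.
Qed.

(** The cardinalities are [2 ^ #|P|] and [2 ^ (2 * n - #|P|)], with [#|P| <= j]. This bounds the
    fraction of [perpZ n j] that is inadmissible as a next generator. *)
Lemma card_spanZ_perpZ n j :
  (#|spanZ n j| * 4 ^ n <= #|perpZ n j| * 4 ^ j)%N.
Proof.
set P := [pred i : 'I_n | (i < j)%N].
have -> : #|spanZ n j| = (2 ^ #|P|)%N.
  rewrite -card_bits_supported -[RHS]mul1n -(cards1 (0 : bits n)) -cardsX.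
  congr #|pred_of_set _|; apply/setP => -[x y]; rewrite !inE /=; congr (_ && _).
  by apply: eq_forallb => i; rewrite -leqNgt.
have -> : #|perpZ n j| = (2 ^ #|predC P| * 2 ^ n)%N.
  rewrite -card_bits_supported.
  have -> : (2 ^ n)%N = #|[set: bits n]|.
    by rewrite cardsT card_ffun card_bool card_ord.
  rewrite -cardsX.
  congr #|pred_of_set _|; apply/setP => -[x y]; rewrite !inE /= andbT.
  by apply: eq_forallb => i; rewrite negbK.
have := cardC P; rewrite card_ord => cP.
rewrite -[4%N]/(2 ^ 2)%N -!expnM -!expnD leq_exp2l //.
have := card_ord_ltn n j; rewrite -/P => Pj.
by move: cP Pj; move: #|P| #|predC P| => a b; lia.
Qed.

Lemma signr_sum (R : pzRingType) (I : Type) (r : seq I) (F : I -> bool) :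
  (-1) ^+ nat_of_bool (\sum_(i <- r) F i) = \prod_(i <- r) (-1) ^+ F i :> R.
Proof.
elim: r => [|i r IHr]; first by rewrite !big_nil.
by rewrite !big_cons -IHr -signr_addb.
Qed.

Section CharacterSum.
Variable n : nat.
Local Notation V := (bits n * bits n)%type.

(** Shifting [w] by a [v] that anticommutes with [a] flips every sign, so the sum is its own
    negative. *)
Lemma sum_character j (a : V) : a \in perpZ n j -> a \notin spanZ n j ->
  \sum_(w in perpZ n j) (-1) ^+ sympl a w = 0 :> int.
Proof.
move=> Ha Ha'; have [v Hv av] := sympl_nondegenerate Ha Ha'.
set S := \sum_(w in _) _.
suff : S = - S by lia.
rewrite {1}/S (reindex_inj (addIr v)) /= -sumrN.
apply: eq_big => [w|w _].
  apply/idP/idP => [Hw|Hw]; last exact: perpZD.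
  by rewrite -(addv_selfK w v) perpZD.
by rewrite symplDr av; case: (sympl a w).
Qed.

Lemma sympl_sum (I : finType) (P : pred I) (d : I -> V) w :
  sympl (\sum_(i | P i) d i) w = \sum_(i | P i) sympl (d i) w.
Proof.
apply: (big_morph (fun a => sympl a w)) => [a b|]; first exact: symplDl.
by rewrite symplC sympl0.
Qed.

Lemma perpZ_sum j (I : finType) (P : pred I) (d : I -> V) :
  (forall i, d i \in perpZ n j) -> \sum_(i | P i) d i \in perpZ n j.
Proof.
move=> Hd; apply: (big_ind (fun a => a \in perpZ n j)) => //.
- by apply/perpZP => i _; rewrite ffunE.
- by move=> a b; apply: perpZD.
Qed.

Definition independent_mod (A : {set V}) L (d : 'I_L -> V) :=
  [forall b : bits L, (b != 0) ==> (subsum d b \notin A)].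

(** The product of the [1 + (-1) ^+ sympl (d i) w] is [2 ^ L] when [w] is orthogonal to all [d i],
    and zero otherwise. Expanded, it is a sum of characters indexed by the subset sums; by
    independence only the empty one survives summation over [w]. *)
Lemma card_perpZ_orthogonal j L (d : 'I_L -> V) :
  (forall i, d i \in perpZ n j) -> independent_mod (spanZ n j) d ->
  (#|[set w in perpZ n j | [forall i, ~~ sympl (d i) w]]| * 2 ^ L = #|perpZ n j|)%N.
Proof.
move=> Hd /forallP Hi.
have expand w : \prod_(i < L) (1 + (-1) ^+ sympl (d i) w) =
    \sum_(b : bits L) (-1) ^+ sympl (subsum d b) w :> int.
  rewrite (eq_bigr (fun i => \sum_(c : bool) (-1) ^+ (c && sympl (d i) w))); last first.
    by move=> i _; rewrite big_bool /= addrC expr0.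
  rewrite bigA_distr_bigA; apply: eq_bigr => b _.
  rewrite /subsum sympl_sum [in RHS]big_mkcond /=.
  rewrite signr_sum.
  by apply: eq_bigr => i _; case: (b i).
have : \sum_(w in perpZ n j) \prod_(i < L) (1 + (-1) ^+ sympl (d i) w) =
       (#|perpZ n j|)%:R :> int.
  under eq_bigr do rewrite expand.
  rewrite exchange_big (bigD1 (0 : bits L)) //= [X in _ + X]big1 ?addr0; last first.
    move=> b b0; apply: sum_character; first exact: perpZ_sum.
    exact: (implyP (Hi b)).
  rewrite -sum1_card natr_sum; apply: eq_bigr => w _.
  by rewrite /subsum big_pred0 => [|i]; [rewrite symplC sympl0 | rewrite ffunE].
rewrite (bigID (fun w => [forall i, ~~ sympl (d i) w])) /= [X in _ + X]big1; last first.
  move=> w /andP[_]; rewrite negb_forall => /existsP[l]; rewrite negbK => dlw.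
  by rewrite (bigD1 l) //= dlw expr1 subrr mul0r.
rewrite addr0 (eq_bigr (fun=> (2 ^ L)%:R)); last first.
  move=> w /andP[_ /forallP wd].
  rewrite (eq_bigr (fun=> 2%:R)) ?prodr_const ?card_ord ?natrX // => i _.
  by rewrite (negPf (wd i)).
rewrite sumr_const -mulrnA => /eqP; rewrite eqr_nat => /eqP <-.
by rewrite mulnC cardsE.
Qed.

End CharacterSum.

(** The inductive step of [exists_few_survivors], with [x = 4 ^ j], [y = 4 ^ n], [l = 2 ^ L],
    [a = 2 ^ (L * j)]. Excluding the [Z] inadmissible vectors costs a factor at most [y / (y - x)],
    absorbed because [(2 * y - 4 * x) * y <= (y - x) * (2 * y - x)]. *)
Lemma greedy_arith (s t l a x y P D Z Phi M : nat) :
  (0 < D -> 0 < y -> 4 * x <= y -> s <= t -> P = D + Z -> Z * y <= P * x ->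
   t * l * D <= Phi * P -> Phi * a * (2 * y - x) <= M * (2 * y) ->
   s * (a * l) * (2 * y - 4 * x) <= M * (2 * y))%N.
Proof.
move=> D0 y0 xy st PDZ ZP tD Hind.
have DP : (P * (y - x) <= D * y)%N by rewrite mulnBr leq_subLR; nia.
have tP : (t * l * (y - x) <= Phi * y)%N.
  have P0 : (0 < P)%N by lia.
  rewrite -(leq_pmul2l P0).
  apply: (@leq_trans (t * l * (D * y))); first by rewrite mulnCA leq_mul2l DP orbT.
  by rewrite mulnA [leqRHS]mulnA leq_mul2r [(P * Phi)%N]mulnC tD orbT.
rewrite -(leq_pmul2r y0).
apply: (@leq_trans (a * (t * l * (y - x)) * (2 * y - x))); last first.
  apply: (@leq_trans (a * (Phi * y) * (2 * y - x))); last by nia.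
  by rewrite leq_mul2r leq_mul2l tP !orbT.
apply: (@leq_trans (a * (t * l) * ((2 * y - 4 * x) * y))).
  rewrite -!mulnA [(s * _)%N]mulnCA leq_mul2l; apply/orP; right.
  by apply: leq_mul.
rewrite -!mulnA !leq_mul2l; do 3 (apply/orP; right).
nia.
Qed.

Section Greedy.
Variables (n L : nat) (B : {set bits n * bits n}).
Local Notation V := (bits n * bits n)%type.
Local Notation tuples := {ffun 'I_L.+1 -> V}.

Definition diffs (f : 'I_L.+1 -> V) (i : 'I_L) : V := f (lift ord0 i) + f ord0.

(** The bad event after [j] generators, in coordinates where these are the first [ez i]: the [L + 1]
    errors have equal syndromes, and their differences are independent modulo the stabilizer. *)
Definition alive j (f : 'I_L.+1 -> V) : bool :=
  [forall i, diffs f i \in perpZ n j] && independent_mod (spanZ n j) (diffs f).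

Definition survivors j ws : {set tuples} :=
  [set e : tuples | [forall i, e i \in B] && alive j (fun i => transvs ws (e i))].

Lemma diffs_transvs us (f : 'I_L.+1 -> V) i :
  diffs (fun i => transvs us (f i)) i = transvs us (diffs f i).
Proof. by rewrite /diffs transvsD. Qed.

Lemma transvs_spanZ us j a : (forall i : 'I_n, (i < j)%N -> transvs us (ez i) = ez i) ->
  a \in spanZ n j -> transvs us a = a.
Proof.
move=> Hus; case: a => x y; rewrite inE /= => /andP[/eqP -> /forallP Hy].
have -> : (0, y) = \sum_(i | y i) ez i :> V.
  rewrite [RHS]surjective_pairing; congr (_, _).
    by rewrite (raddf_sum fst) big1.
  rewrite (raddf_sum snd); apply/ffunP => k.
  rewrite sum_ffunE big_mkcond (bigD1 k) //= big1 ?addr0 => [|i ik].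
    by case E: (y k); rewrite // !ffunE eqxx.
  by case: (y i); rewrite // !ffunE eq_sym (negPf ik).
rewrite transvs_sum; apply: eq_bigr => i yi; apply: Hus.
by rewrite ltnNge; apply/negP => ji; move: (Hy i); rewrite ji yi.
Qed.

(** The map [us] preserves the form, fixes [spanZ n j] pointwise and sends [w] to [ez j]. Hence
    being alive at [j + 1] pulls back to being alive at [j] with differences that also commute with
    [w]. *)
Lemma survivors_step (j : 'I_n) ws us w :
  (forall i : 'I_n, (i < j)%N -> transvs us (ez i) = ez i) ->
  transvs us w = ez j ->
  survivors j.+1 (us ++ ws) \subset
    [set e in survivors j ws |
      [forall i, ~~ sympl (diffs (fun i => transvs ws (e i)) i) w]].
Proof.
move=> Hus usw; apply/subsetP => e.
rewrite !inE => /andP[-> /andP[/forallP Hp /forallP Hi]] /=.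
pose d := diffs (fun i => transvs ws (e i)).
have dE i : diffs (fun i => transvs (us ++ ws) (e i)) i = transvs us (d i).
  by rewrite /d -diffs_transvs /diffs !transvs_cat.
apply/andP; split; last first.
  apply/forallP => i; rewrite -(sympl_transvs us) -/(d i) -dE usw sympl_ez.
  by move/perpZP: (Hp i) => ->.
apply/andP; split.
  apply/forallP => i; rewrite -/(d i); apply/perpZP => k kj.
  rewrite -sympl_ez -(sympl_transvs us) Hus // -dE sympl_ez.
  by move/perpZP: (Hp i) => -> //; apply: leqW.
apply/forallP => b; apply/implyP => b0; have := implyP (Hi b) b0.
apply: contra => Hb.
have -> : subsum (diffs (fun i => transvs (us ++ ws) (e i))) b = subsum d b.
  rewrite -(transvs_spanZ Hus Hb) /subsum transvs_sum.
  by apply: eq_bigr => i _; rewrite dE.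
move: Hb; rewrite !inE -/d => /andP[-> /forallP Hb]; apply/forallP => i.
by apply/implyP => ji; apply: (implyP (Hb i)); apply: ltnW.
Qed.

(** The factor [2 * 4 ^ n - 4 ^ j] accounts for the losses from excluding [spanZ] at each step. It
    never falls below half of [2 * 4 ^ n], so the total loss is at most a factor 2. *)
Lemma exists_few_survivors j : (j <= n)%N -> exists ws,
  (#|survivors j ws| * 2 ^ (L * j) * (2 * 4 ^ n - 4 ^ j) <=
   #|B| ^ L.+1 * (2 * 4 ^ n))%N.
Proof.
elim: j => [_|j IHj jn].
  exists [::]; rewrite muln0 expn0 muln1; apply: leq_mul; last by rewrite leq_subr.
  have -> : (#|B| ^ L.+1 = #|[set e : tuples | [forall i, e i \in B]]|)%N.
    rewrite -[in LHS](card_ord L.+1) -card_ffun_on cardsE; apply: eq_card => e.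
    by rewrite unfold_in; apply/ffun_onP/forallP.
  by apply: subset_leq_card; apply/subsetP => e; rewrite !inE => /andP[].
have [ws Hws] := IHj (ltnW jn).
pose jo := Ordinal jn.
pose S w := [set e in survivors j ws |
      [forall i, ~~ sympl (diffs (fun i => transvs ws (e i)) i) w]].
have exj : ex jo \in perpZ n j :\: spanZ n j.
  rewrite inE ex_perpZ // andbT inE /= negb_and; apply/orP; left.
  by apply/eqP => /ffunP/(_ jo); rewrite !ffunE eqxx.
(* Double counting: each surviving tuple has its differences orthogonal to exactly a fraction 2^-L
   of [perpZ n j]. Some admissible [w] then does no worse than the average. *)
have sumS : (\sum_(w in perpZ n j :\: spanZ n j) #|S w| * 2 ^ L <=
             #|survivors j ws| * #|perpZ n j|)%N.
  apply: (@leq_trans (\sum_(w in perpZ n j) #|S w| * 2 ^ L)).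
    rewrite [leqRHS](bigID (fun w => w \in spanZ n j)) /= addnC -[leqLHS]addn0.
    apply: leq_add => //; apply/eq_leq/eq_bigl => w; first by rewrite inE andbC.
  rewrite -big_distrl /=.
  have -> : (\sum_(w in perpZ n j) #|S w| = \sum_(e in survivors j ws)
     #|[set w in perpZ n j | [forall i, ~~ sympl (diffs (fun i => transvs ws (e i)) i) w]]|)%N.
    under eq_bigr do rewrite -sum1_card; under [RHS]eq_bigr do rewrite -sum1_card.
    rewrite (exchange_big_dep (mem (survivors j ws))) /=; last first.
      by move=> w e _; rewrite inE => /andP[].
    by apply: eq_bigr => e He; apply: eq_bigl => w;
       rewrite [RHS]inE; congr (_ && _); rewrite inE He.
  rewrite big_distrl /= -sum_nat_const; apply: leq_sum => e.
  rewrite inE => /andP[_ /andP[/forallP Hp Hi]].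
  by rewrite card_perpZ_orthogonal.
have [w] := exists_le_average exj sumS.
rewrite inE => /andP[ww' ww] Hw.
have [us [Hus usw]] := @transvs_transitive _ jo w ww ww'.
exists (us ++ ws).
have Hs : (#|survivors j.+1 (us ++ ws)| <= #|S w|)%N.
  exact/subset_leq_card/(@survivors_step jo).
have Hc := card_spanZ_perpZ n j.
have Hd : #|perpZ n j| = (#|perpZ n j :\: spanZ n j| + #|spanZ n j|)%N.
  rewrite -(cardsID (spanZ n j)) addnC; congr (_ + #|pred_of_set _|)%N.
  apply/setIidPr/subsetP => a; rewrite inE => /andP[/eqP a1 _].
  by apply/perpZP => i _; rewrite a1 ffunE.
have P0 : (0 < #|perpZ n j :\: spanZ n j|)%N by apply/card_gt0P; exists (ex jo).
move: Hws Hw Hs Hc Hd P0.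
have -> : (L * j.+1 = L * j + L)%N by rewrite mulnS addnC.
rewrite expnD (expnS 4 j) => Hws Hw Hs Hc Hd P0.
apply: (greedy_arith (t := #|S w|) (P := #|perpZ n j|) (Phi := #|survivors j ws|)
                     P0 _ _ Hs Hd Hc) => //.
  by rewrite expn_gt0.
by rewrite -expnS leq_exp2l.
Qed.

End Greedy.

(** * Syndrome and logical coordinates *)

Section Blocks.
Variables m k : nat.

Definition lowb (x : bits (m + k)) : bits m := [ffun i => x (lshift k i)].
Definition highb (x : bits (m + k)) : bits k := [ffun i => x (rshift m i)].
Definition joinb (x : bits m) (y : bits k) : bits (m + k) :=
  [ffun i => match split i with inl j => x j | inr j => y j end].

Lemma lowbK x y : lowb (joinb x y) = x.
Proof. by apply/ffunP => i; rewrite !ffunE (unsplitK (inl i)). Qed.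

Lemma highbK x y : highb (joinb x y) = y.
Proof. by apply/ffunP => i; rewrite !ffunE (unsplitK (inr i)). Qed.

Lemma joinbK x : joinb (lowb x) (highb x) = x.
Proof.
by apply/ffunP => i; rewrite ffunE; case: splitP => j ij; rewrite ffunE;
   congr (x _); apply: val_inj.
Qed.

Lemma lowbD x y : lowb (x + y) = lowb x + lowb y.
Proof. by apply/ffunP => i; rewrite !ffunE. Qed.

Lemma highbD x y : highb (x + y) = highb x + highb y.
Proof. by apply/ffunP => i; rewrite !ffunE. Qed.

Lemma dotb_split x y :
  dotb x y = dotb (lowb x) (lowb y) + dotb (highb x) (highb y).
Proof.
rewrite /dotb big_split_ord; congr (_ + _); apply: eq_bigr => i _;
  by rewrite !ffunE.
Qed.

Definition highv (a : bits (m + k) * bits (m + k)) : bits k * bits k :=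
  (highb a.1, highb a.2).

Lemma highvD a b : highv (a + b) = highv a + highv b.
Proof. by rewrite /highv !highbD. Qed.

Lemma highv0 : highv 0 = 0.
Proof. by congr (_, _); apply/ffunP => i; rewrite !ffunE. Qed.

Lemma highv_subsum L (d : 'I_L -> bits (m + k) * bits (m + k)) b :
  highv (subsum d b) = subsum (fun i => highv (d i)) b.
Proof. by rewrite /subsum (big_morph _ highvD highv0). Qed.

Lemma highv_spanZ a : a \in spanZ (m + k) m -> highv a = 0.
Proof.
rewrite inE => /andP[/eqP a1 /forallP a2].
rewrite /highv a1; congr (_, _); apply/ffunP => i; rewrite !ffunE //.
by apply: negbTE; apply: (implyP (a2 _)); rewrite /= leq_addr.
Qed.

(** Without survivors, the logical parts of the errors in [B] sharing a syndrome are affinely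
    [L]-dependent, so [span_of_affine_dependent] yields a list for that syndrome. *)
Lemma exists_list_decodable (L : nat) (B : {set bits (m + k) * bits (m + k)}) :
  (0 < L)%N -> (2 * #|B| ^ L.+1 < 2 ^ (L * m))%N ->
  exists ws, forall s : bits m, exists d : 'I_L -> bits k * bits k,
    forall e, e \in B -> lowb (transvs ws e).1 = s ->
    exists b, highv (transvs ws e) = subsum d b.
Proof.
move=> L0 BL; have [ws Hws] := exists_few_survivors L B (leq_addr k m).
exists ws => s.
(* As [2 * 4 ^ (m + k) - 4 ^ m] is at least [4 ^ (m + k)], a survivor would force
   [2 ^ (L * m) <= 2 * #|B| ^ L.+1]. *)
have surv0 : survivors L B m ws = set0.
  apply/eqP; rewrite -cards_eq0 -leqn0 leqNgt; apply/negP => S0.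
  have mk : (4 ^ m <= 4 ^ (m + k))%N by rewrite leq_exp2l ?leq_addr.
  have y0 : (0 < 4 ^ (m + k))%N by rewrite expn_gt0.
  move: Hws S0 BL mk y0.
  move: #|survivors _ _ _ _| (#|B| ^ L.+1)%N (2 ^ (L * m))%N (4 ^ m)%N (4 ^ (m + k))%N.
  move=> a b c x y Hws a0 bc xy y0.
  have : (c * y <= 2 * b * y)%N.
    apply: leq_trans (_ : b * (2 * y) <= _)%N; last by rewrite mulnA [(b * 2)%N]mulnC.
    apply: leq_trans Hws; apply: leq_mul; first by rewrite leq_pmull.
    by rewrite leq_subRL; lia.
  by rewrite leq_pmul2r // leqNgt bc.
pose X := [seq highv (transvs ws e) | e <- enum B & lowb (transvs ws e).1 == s].
have XP x : x \in X -> exists e, [&& e \in B, lowb (transvs ws e).1 == s &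
                                    x == highv (transvs ws e)].
  case/mapP => e; rewrite mem_filter mem_enum => /andP[es eB] ->.
  by exists e; rewrite es eB eqxx.
have [f fX|d dX] := @span_of_affine_dependent _ (@addv_self k) X L L0; last first.
  exists d => e eB es; apply: dX; apply/mapP; exists e => //.
  by rewrite mem_filter es eqxx mem_enum.
have [g gP] := fin_all_exists (fun i => XP _ (fX i)).
(* The lifted tuple lies in [B] and has equal syndromes, so only independence can fail; the subset
   sum in [spanZ] has zero logical part. *)
have : [ffun i => g i] \notin survivors L B m ws by rewrite surv0 inE.
rewrite inE negb_and => /orP[/negP[]|].
  by apply/forallP => i; rewrite ffunE; case/and3P: (gP i).
rewrite negb_and => /orP[/negP[]|].
  apply/forallP => i; apply/perpZP => j jm; rewrite /diffs !ffunE.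
  have -> : j = lshift k (Ordinal jm) by apply: val_inj.
  have lowg l : (transvs ws (g l)).1 (lshift k (Ordinal jm)) = s (Ordinal jm).
    by case/and3P: (gP l) => _ /eqP <- _; rewrite ffunE.
  by rewrite !lowg; case: (s _).
rewrite negb_forall => /existsP[b]; rewrite negb_imply negbK => /andP[b0 /highv_spanZ bS].
exists b => //; rewrite -bS highv_subsum /subsum; apply: eq_bigr => i _.
rewrite /diffs !ffunE highvD.
by case/and3P: (gP ord0) => _ _ /eqP ->; case/and3P: (gP (lift ord0 i)) => _ _ /eqP ->.
Qed.

End Blocks.

(** * Pauli matrices and Clifford unitaries *)

Section Adjoint.
Variable R : realType.
Local Notation C := R[i].

Lemma adj_mulmx m n p (A : 'M[C]_(m, n)) (B : 'M[C]_(n, p)) :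
  adj (A *m B) = adj B *m adj A.
Proof. by rewrite /adj map_mxM trmx_mul. Qed.

Lemma adj_add m n (A B : 'M[C]_(m, n)) : adj (A + B) = adj A + adj B.
Proof. by rewrite /adj map_mxD linearD. Qed.

Lemma adj_scale m n c (A : 'M[C]_(m, n)) : adj (c *: A) = conjc c *: adj A.
Proof. by rewrite /adj map_mxZ linearZ. Qed.

Lemma adj_1 n : adj (1%:M : 'M[C]_n) = 1%:M.
Proof. by rewrite /adj map_mx1 trmx1. Qed.

Lemma adj_adj m n (A : 'M[C]_(m, n)) : adj (adj A) = A.
Proof. by apply/matrixP => i j; rewrite !mxE conjcK. Qed.

(* A name for the imaginary unit that simplification does not unfold to a pair. *)
Definition iu : C := 'i.

Lemma iu_sqr : iu * iu = -1.
Proof. exact: mulCii. Qed.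

Lemma conjcM (x y : C) : conjc (x * y) = conjc x * conjc y.
Proof. exact: rmorphM. Qed.

Lemma conjcD (x y : C) : conjc (x + y) = conjc x + conjc y.
Proof. exact: rmorphD. Qed.

Lemma conjc_iu : conjc iu = - iu.
Proof.
by rewrite /iu -complexiE /=; apply/eqP; rewrite eq_complex /= oppr0 !eqxx.
Qed.

Lemma conjc_sign (b : bool) : conjc ((-1) ^+ b) = (-1) ^+ b :> C.
Proof.
case: b; last by rewrite expr0 conjc1.
by rewrite expr1; apply: rmorphN1.
Qed.

Lemma phase_unit t : iu ^+ t * conjc (iu ^+ t) = 1.
Proof.
elim: t => [|t IHt]; first by rewrite expr0 conjc1 mulr1.
by rewrite exprS conjcM mulrACA IHt mulr1 conjc_iu mulrN iu_sqr opprK.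
Qed.

Lemma phase_mod4 t : iu ^+ (t %% 4)%N = iu ^+ t.
Proof.
rewrite {2}(divn_eq t 4) exprD mulnC exprM (exprM iu 2 2) (expr2 iu) iu_sqr.
by rewrite sqrrN expr1n expr1n mul1r.
Qed.

Lemma phase_sign (b : bool) : (-1) ^+ b = iu ^+ b.*2.
Proof. by case: b; rewrite //= expr2 iu_sqr. Qed.

End Adjoint.

Arguments iu : simpl never.

Section Weyl.
Variables (R : realType) (n : nat).
Local Notation C := R[i].
Local Notation V := (bits n * bits n)%type.

Definition weyl (a : V) : 'M[C]_(dim n) := pauli_mx R (Pauli ord0 a.1 a.2).

Lemma bxorE (x y : bits n) : bxor x y = x + y.
Proof. by apply/ffunP => i; rewrite !ffunE; case: (x i); case: (y i). Qed.

Lemma ket_idxK (x : bits n) : bit_of (ket_idx x) = x.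
Proof. exact: enum_rankK. Qed.

Lemma bit_ofK (i : 'I_(dim n)) : ket_idx (bit_of i) = i.
Proof. exact: enum_valK. Qed.

Lemma sign_dotb (x y : bits n) :
  (-1) ^+ #|[set k | x k && y k]| = (-1) ^+ dotb x y :> C.
Proof.
rewrite /dotb signr_sum -sum1_card big_mkcond /=.
rewrite (big_morph (fun k => (-1) ^+ k : C) (exprD _) (expr0 _)).
by apply: eq_bigr => k _; rewrite inE; case: (x k); case: (y k).
Qed.

Lemma weylE a i j : weyl a i j =
  if bit_of i == bit_of j + a.1 then (-1) ^+ dotb a.2 (bit_of j) else 0.
Proof. by rewrite mxE expr0 mul1r /= bxorE sign_dotb. Qed.

Lemma pauli_mxE (P : pauli n) :
  pauli_mx R P = iu R ^+ pphase P *: weyl (pX P, pZ P).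
Proof. by apply/matrixP => i j; rewrite !mxE expr0 mul1r. Qed.

Lemma addbits_selfK (x y : bits n) : x + y + y = x.
Proof. by rewrite -addrA addbits_self addr0. Qed.

Lemma mulmx_weyl m (M : 'M[C]_(m, dim n)) b i j : (M *m weyl b) i j =
  M i (ket_idx (bit_of j + b.1)) * (-1) ^+ dotb b.2 (bit_of j).
Proof.
rewrite mxE (bigD1 (ket_idx (bit_of j + b.1))) //= weylE ket_idxK eqxx.
rewrite big1 ?addr0 // => l lj; rewrite weylE ifN ?mulr0 //.
by apply: contra lj => /eqP <-; rewrite bit_ofK.
Qed.

Lemma weyl_mulmx m (M : 'M[C]_(dim n, m)) a i j : (weyl a *m M) i j =
  (-1) ^+ dotb a.2 (bit_of i + a.1) * M (ket_idx (bit_of i + a.1)) j.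
Proof.
rewrite mxE (bigD1 (ket_idx (bit_of i + a.1))) //= weylE ket_idxK addbits_selfK eqxx.
rewrite big1 ?addr0 // => l lj; rewrite weylE ifN ?mul0r //.
by apply: contra lj => /eqP ->; rewrite addbits_selfK bit_ofK.
Qed.

Lemma weylM a b : weyl a *m weyl b = (-1) ^+ dotb a.2 b.1 *: weyl (a + b).
Proof.
apply/matrixP => i j; rewrite mulmx_weyl [RHS]mxE !weylE ket_idxK /=.
rewrite -addrA (addrC b.1); case: eqP => _; last by rewrite mul0r mulr0.
by rewrite dotbDr dotbDl -!signr_addb; congr (_ ^+ nat_of_bool _);
   case: (dotb _ _); case: (dotb _ _); case: (dotb _ _).
Qed.

Lemma weyl0 : weyl 0 = 1%:M.
Proof.
apply/matrixP => i j; rewrite weylE /= addr0 dot0b mxE.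
by rewrite (inj_eq (can_inj bit_ofK)); case: eqP.
Qed.

Lemma adj_weyl a : adj (weyl a) = (-1) ^+ dotb a.1 a.2 *: weyl a.
Proof.
apply/matrixP => i j; rewrite [LHS]mxE [LHS]mxE [RHS]mxE !weylE.
have -> : (bit_of j == bit_of i + a.1) = (bit_of i == bit_of j + a.1).
  by apply/eqP/eqP => ->; rewrite addbits_selfK.
case: eqP => [->|_]; last by rewrite conjc0 mulr0.
rewrite conjc_sign dotbDr (dotbC a.1) -signr_addb; congr (_ ^+ nat_of_bool _).
by rewrite addrC.
Qed.

Lemma weylC a b : weyl a *m weyl b = (-1) ^+ sympl a b *: (weyl b *m weyl a).
Proof.
rewrite !weylM scalerA -signr_addb (addrC b); congr ((-1) ^+ nat_of_bool _ *: _).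
by rewrite /sympl (dotbC a.1); case: (dotb _ _); case: (dotb _ _).
Qed.

Lemma weyl_prod (I : Type) (r : seq I) (P : pred I) (d : I -> V) :
  exists t : bool, \prod_(i <- r | P i) weyl (d i) =
    (-1) ^+ t *: weyl (\sum_(i <- r | P i) d i).
Proof.
elim: r => [|i r [t IHr]]; first by exists false; rewrite !big_nil weyl0 scale1r.
rewrite !big_cons; case: (P i); last by exists t.
rewrite IHr -[_ * _]/(_ *m _) -scalemxAr weylM scalerA -signr_addb.
by eexists.
Qed.

(* [hpauli w] is Hermitian and squares to one, so [(1 + i hpauli w) / sqrt 2] is
   unitary; [(1 + i) / 2] is [1 / sqrt 2] up to a phase. *)
Definition hpauli (w : V) : 'M[C]_(dim n) := iu R ^+ dotb w.1 w.2 *: weyl w.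

Lemma hpauli_sqr w : hpauli w *m hpauli w = 1%:M.
Proof.
rewrite /hpauli -scalemxAl -scalemxAr scalerA weylM scalerA addv_self weyl0.
rewrite dotbC phase_sign -!exprD addnn -phase_mod4.
by case: (dotb _ _); rewrite /= scale1r.
Qed.

Lemma adj_hpauli w : adj (hpauli w) = hpauli w.
Proof.
rewrite /hpauli adj_scale adj_weyl scalerA; case: (dotb _ _).
  by rewrite !expr1 conjc_iu mulrN1 opprK.
by rewrite !expr0 mulr1 conjc1.
Qed.

Definition transv_mx (w : V) : 'M[C]_(dim n) :=
  ((1 + iu R) / 2) *: (1%:M + iu R *: hpauli w).

Lemma transv_mx_unitary w : adj (transv_mx w) *m transv_mx w = 1%:M.
Proof.
rewrite /transv_mx adj_scale -scalemxAl -scalemxAr scalerA.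
rewrite adj_add adj_scale adj_hpauli adj_1 conjc_iu.
move: (hpauli w) (hpauli_sqr w) => h hh.
rewrite mulmxDl !mulmxDr !mul1mx mulmx1 -!scalemxAl -!scalemxAr hh.
rewrite scaleNr scalerA mulNr iu_sqr opprK scale1r addrA addrK.
have -> : conjc ((1 + iu R) / 2) * ((1 + iu R) / 2) = 2^-1 :> C.
  rewrite conjcM conjcD conjc1 conjc_inv conjc_nat conjc_iu.
  have e : (1 - iu R) * (1 + iu R) = 2 :> C.
    by rewrite -subr_sqr expr1n expr2 iu_sqr opprK.
  by rewrite mulrACA e -invfM; field.
have -> : 1%:M + 1%:M = 2 *: 1%:M :> 'M[C]_(dim n) by rewrite scaler_nat mulr2n.
by rewrite scalerA mulVf ?scale1r // pnatr_eq0.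
Qed.

(** With [h = hpauli w], an anticommuting [weyl a] turns 1 + i h into 1 - i h = (1 + i h)(- i h),
    and [h *m weyl a] is [weyl (a + w)] up to a phase. Phases are left unspecified since they cancel
    on density matrices. *)
Lemma weyl_transv_mx w a : exists t,
  weyl a *m transv_mx w = iu R ^+ t *: (transv_mx w *m weyl (transv w a)).
Proof.
have hC : weyl a *m hpauli w = (-1) ^+ sympl a w *: (hpauli w *m weyl a).
  by rewrite /hpauli -scalemxAr weylC -scalemxAl !scalerA; congr (_ *: _); rewrite mulrC.
rewrite /transv; case: (sympl a w) hC => hC.
  have [t ht] : exists t, weyl (a + w) = iu R ^+ t *: (hpauli w *m weyl a).
    set d := dotb w.1 w.2; set e := dotb w.2 a.1.
    exists (3 * d + 2 * e)%N.
    rewrite /hpauli -scalemxAl weylM -/d -/e !scalerA addrC (phase_sign R) -!exprD.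
    by rewrite -phase_mod4; case: d; case: e; rewrite /= expr0 scale1r.
  (* This is - i = i^3 times the inverse i^(3 t) of the phase i^t. *)
  exists (3 + 3 * t)%N.
  rewrite ht /transv_mx; move: (hpauli w) (hpauli_sqr w) hC {ht} => h hh.
  rewrite expr1 scaleN1r => hC.
  rewrite -[in RHS]scalemxAr scalerA -exprD -phase_mod4.
  have -> : ((3 + 3 * t + t) %% 4)%N = 3%N by lia.
  have -> : iu R ^+ 3 = - iu R by rewrite exprS expr2 iu_sqr mulrN1.
  move: ((1 + iu R) / 2) => c.
  rewrite -scalemxAr -scalemxAl scalerA (mulrC (- iu R)) -scalerA; congr (_ *: _).
  rewrite mulmxDr mulmx1 -scalemxAr hC mulmxDl mul1mx -scalemxAl mulmxA hh mul1mx.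
  by rewrite scalerDr scalerA mulNr iu_sqr opprK scale1r scalerN scaleNr addrC.
exists 0%N; rewrite expr0 !scale1r in hC *.
rewrite /transv_mx; move: (hpauli w) hC => h hC.
by rewrite -scalemxAr -scalemxAl mulmxDr mulmxDl mulmx1 mul1mx
  -scalemxAr -scalemxAl hC.
Qed.

Lemma transvs_unitary ws : exists2 U : 'M[C]_(dim n), adj U *m U = 1%:M &
  forall a, exists t, weyl a *m U = iu R ^+ t *: (U *m weyl (transvs ws a)).
Proof.
elim: ws => [|w ws [U UU HU]].
  by exists 1%:M; rewrite ?adj_1 ?mulmx1 // => a; exists 0%N;
     rewrite expr0 scale1r mulmx1 mul1mx.
exists (U *m transv_mx w).
  by rewrite adj_mulmx mulmxA -(mulmxA (adj _)) UU mulmx1 transv_mx_unitary.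
move=> a; have [t ht] := HU a.
have [t' ht'] := weyl_transv_mx w (transvs ws a).
exists (t + t')%N; rewrite mulmxA ht -scalemxAl -mulmxA ht' -scalemxAr scalerA.
by rewrite -exprD mulmxA.
Qed.

End Weyl.

(** * The code and its decoder *)

Section Registers.
Variables (R : realType) (m k : nat).
Local Notation C := R[i].

Lemma sum_bit_of n (x : bits n) (G : 'I_(dim n) -> C) :
  \sum_l (bit_of l == x)%:R * G l = G (ket_idx x).
Proof.
rewrite (bigD1 (ket_idx x)) //= ket_idxK eqxx mul1r big1 ?addr0 // => l lx.
by rewrite (can2_eq (@bit_ofK n) (@ket_idxK n)) (negPf lx) mul0r.
Qed.

Lemma outerE n p (v : 'cV[C]_n) (w : 'cV[C]_p) i j :
  (v *m adj w) i j = v i 0 * conjc (w j 0).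
Proof. by rewrite mxE big_ord1 !mxE. Qed.

Definition embed : 'M[C]_(dim (m + k), dim k) :=
  \matrix_(i, j) (bit_of i == joinb (0 : bits m) (bit_of j))%:R.

Lemma embed_mulmx p (M : 'M[C]_(dim k, p)) i j : (embed *m M) i j =
  if lowb (bit_of i) == 0 then M (ket_idx (highb (bit_of i))) j else 0.
Proof.
rewrite mxE; case: eqP => [i0|i0].
  rewrite -[RHS](sum_bit_of _ (fun l => M l j)); apply: eq_bigr => l _.
  rewrite mxE; congr ((nat_of_bool _)%:R * _); apply/eqP/eqP => [->|->].
    by rewrite highbK.
  by rewrite -i0 joinbK.
apply: big1 => l _; rewrite mxE; case: eqP => [il|_]; last by rewrite mul0r.
by case: i0; rewrite il lowbK.
Qed.

Lemma adj_embed_mulmx p (M : 'M[C]_(dim (m + k), p)) i j :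
  (adj embed *m M) i j = M (ket_idx (joinb 0 (bit_of i))) j.
Proof.
rewrite mxE -[RHS](sum_bit_of _ (fun l => M l j)).
by apply: eq_bigr => l _; rewrite !mxE conjc_nat.
Qed.

Lemma embed_isometry : adj embed *m embed = 1%:M.
Proof.
apply/matrixP => i j; rewrite adj_embed_mulmx !mxE ket_idxK.
congr (nat_of_bool _)%:R; apply/eqP/eqP => [ij|-> //].
by rewrite -(bit_ofK i) -[bit_of i](highbK (0 : bits m)) ij highbK bit_ofK.
Qed.

(** Regroups the qubits into two registers, the logical one first, in the order of the decoder
    output in [list_code]. *)
Definition unjoin : 'M[C]_(dim k * dim m, dim (m + k)) :=
  \matrix_(i, j) (bit_of j ==
    joinb (bit_of (mxtens_unindex i).2) (bit_of (mxtens_unindex i).1))%:R.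

Lemma unjoin_mulmx p (M : 'M[C]_(dim (m + k), p)) i j : (unjoin *m M) i j =
  M (ket_idx (joinb (bit_of (mxtens_unindex i).2) (bit_of (mxtens_unindex i).1))) j.
Proof.
rewrite mxE -[RHS](sum_bit_of _ (fun l => M l j)).
by apply: eq_bigr => l _; rewrite mxE.
Qed.

Lemma unjoin_isometry : adj unjoin *m unjoin = 1%:M.
Proof.
apply/matrixP => i j; rewrite mxE.
pose i0 := mxtens_index (ket_idx (highb (bit_of i)), ket_idx (lowb (bit_of i))).
rewrite (bigD1 i0) //= !mxE mxtens_indexK /= !ket_idxK joinbK eqxx conjc_nat mul1r.
rewrite big1 ?addr0 => [|l li].
  by rewrite (inj_eq (can_inj (@bit_ofK _))) eq_sym.
rewrite !mxE; case: eqP => [il|_]; last by rewrite conjc_nat mul0r.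
case/eqP: li; rewrite /i0 il highbK lowbK !bit_ofK -surjective_pairing.
by rewrite mxtens_unindexK.
Qed.

(* On [|0> (x) |phi>] a Pauli operator acts as a bit flip of the first register
   and as a Pauli operator on [phi]. *)
Lemma unjoin_weyl_embed (a : bits (m + k) * bits (m + k)) (phi : 'cV[C]_(dim k)) i j :
  (unjoin *m (weyl R a *m (embed *m phi))) i j =
  (bit_of (mxtens_unindex i).2 == lowb a.1)%:R *
  (weyl R (highv a) *m phi) (mxtens_unindex i).1 j.
Proof.
rewrite unjoin_mulmx !weyl_mulmx embed_mulmx !ket_idxK.
set s := bit_of _.2; set x := bit_of _.1.
rewrite dotb_split !lowbD !highbD lowbK highbK.
have -> : (s + lowb a.1 == 0) = (s == lowb a.1).
  by apply/eqP/eqP => [sa|->]; rewrite ?addbits_self //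
     -[s](addbits_selfK _ (lowb a.1)) sa add0r.
case: eqP => [->|_]; last by rewrite mulr0 mul0r.
by rewrite addbits_self dotb0 add0r mul1r.
Qed.

End Registers.

Section Code.
Variables (R : realType) (m k t L : nat).
Local Notation C := R[i].
Local Notation n := (m + k)%N.

Lemma weyl_in_list_span (d : 'I_L -> bits k * bits k) (b : bits L) :
  in_list_span (fun l => Pauli ord0 (d l).1 (d l).2) (weyl R (subsum d b)).
Proof.
have [c Hc] := weyl_prod R (index_enum 'I_L) (fun l => b l) d.
exists (fun b' => if b' == b then (-1) ^+ c else 0).
rewrite (bigD1 b) //= eqxx [X in _ + X]big1 ?addr0 => [|b' /negPf ->]; last first.
  by rewrite scale0r.
by rewrite Hc scalerA -signr_addb addbb scale1r.
Qed.

Lemma in_list_span0 (P : 'I_L -> pauli k) : in_list_span (R := R) P 0.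
Proof. by exists (fun=> 0); rewrite big1 // => b _; rewrite scale0r. Qed.

(* The body of [list_code], with the number of generators freed from [n - k]. *)
Definition list_code_at n' m' : Prop :=
  exists S : 'I_m' -> pauli n',
  stabilizer_generators R S /\
  exists Enc : 'M[C]_(dim n', dim k),
  encoding S Enc /\
  exists (J : nat) (D : 'I_J -> 'M[C]_(dim k * dim m', dim n')),
  trace_preserving D /\
  exists P : bits m' -> 'I_L -> pauli k,
  forall E : pauli n', (weight E <= t)%N ->
  exists (J' : nat) (A : bits m' -> 'I_J' -> 'M[C]_(dim k)),
    \sum_(s : bits m') \sum_(j < J') adj (A s j) *m A s j = 1%:M /\
    (forall s j, in_list_span (P s) (A s j)) /\
    forall phi : 'cV[C]_(dim k), adj phi *m phi = 1%:M ->
      let psi := pauli_mx R E *m (Enc *m phi) in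
      apply_channel D (psi *m adj psi) =
      \sum_(s : bits m') \sum_(j < J')
         ((A s j *m (phi *m adj phi) *m adj (A s j)) *t proj_syn R s).

(** The support clause serves the independence of the generators. *)
Lemma ez_sum (s : seq 'I_m) :
  exists z : bits m, \sum_(j <- s) ez (lshift k j) = (0, joinb z 0) /\
    (forall j, j \notin s -> z j = 0).
Proof.
elim: s => [|i s [z [Hz zs]]].
  exists 0; split=> [|j _]; last by rewrite ffunE.
  rewrite big_nil; congr (_, _); apply/ffunP => i; rewrite !ffunE.
  by case: split => j; rewrite ffunE.
exists (ebit i + z); split=> [|j].
  rewrite big_cons Hz /ez -[LHS]/(_, _); congr (_, _); rewrite ?addr0 //.
  apply/ffunP => l; rewrite !ffunE; case: splitP => j lj.
    by rewrite !ffunE -val_eqE /= lj.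
  rewrite ffunE addr0 -val_eqE /= lj.
  by rewrite -[RHS]/false; apply/eqP => ij; have := ltn_ord i; rewrite -ij ltnNge leq_addr.
rewrite inE negb_or => /andP[ji js].
by rewrite !ffunE (negPf ji) zs.
Qed.

Variables (ws : seq (bits n * bits n)) (U : 'M[C]_(dim n)).
Hypothesis UU : adj U *m U = 1%:M.
Hypothesis HU : forall a, exists t,
  weyl R a *m U = iu R ^+ t *: (U *m weyl R (transvs ws a)).

Let UUc : U *m adj U = 1%:M.
Proof. exact: mulmx1C. Qed.

(** The operator comes from the preimage of [ez (lshift k j)] under [transvs ws]; its phase i^(3 u)
    inverts the i^u of the intertwining relation. *)
Lemma exists_conj_Z (j : 'I_m) : exists P : pauli n,
  pauli_mx R P = U *m weyl R (ez (lshift k j)) *m adj U.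
Proof.
have [u Hu] := HU (transvs (rev ws) (ez (lshift k j))).
rewrite transvs_revK in Hu.
set a := transvs _ _ in Hu.
have lt4 : ((3 * u) %% 4 < 4)%N by rewrite ltn_pmod.
exists (Pauli (Ordinal lt4) a.1 a.2).
rewrite pauli_mxE /= phase_mod4 -surjective_pairing.
have -> : U *m weyl R (ez (lshift k j)) = iu R ^+ (3 * u) *: (weyl R a *m U).
  rewrite Hu scalerA -exprD -mulSnr -phase_mod4.
  by rewrite modnMr expr0 scale1r.
by rewrite -scalemxAl -mulmxA UUc mulmx1.
Qed.

Variable S : 'I_m -> pauli n.
Hypothesis HS : forall j, pauli_mx R (S j) = U *m weyl R (ez (lshift k j)) *m adj U.

Lemma stabilizer_prod (s : seq 'I_m) : exists z : bits m,
  \prod_(j <- s) pauli_mx R (S j) = U *m weyl R (0, joinb z 0) *m adj U /\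
  (forall j, j \notin s -> z j = 0).
Proof.
have [z [Hz zs]] := ez_sum s; exists z; split=> //; rewrite -Hz.
elim: s {z Hz zs} => [|i s IH]; first by rewrite !big_nil weyl0 mulmx1 UUc.
rewrite !big_cons IH HS -[_ * _]/(_ *m _).
rewrite !mulmxA -(mulmxA _ (adj U) U) UU mulmx1 -(mulmxA U) weylM.
have -> : dotb (ez (lshift k i)).2 (\sum_(j <- s) ez (lshift k j)).1 = 0.
  have [z [-> _]] := ez_sum s; exact: dotb0.
by rewrite scale1r.
Qed.

Lemma conj_unitary_inj (A B : 'M[C]_(dim n)) :
  U *m A *m adj U = U *m B *m adj U -> A = B.
Proof.
move=> AB; have : adj U *m (U *m A *m adj U) *m U = adj U *m (U *m B *m adj U) *m U.
  by rewrite AB.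
by rewrite !mulmxA UU !mul1mx -!mulmxA UU !mulmx1.
Qed.

Lemma weyl_Z_diag (z : bits n) i : weyl R (0, z) i i = (-1) ^+ dotb z (bit_of i).
Proof. by rewrite weylE /= addr0 eqxx. Qed.

Lemma neq1N1 : (1 : C) <> -1.
Proof. by move=> /eqP; rewrite eq_sym -subr_eq0 -opprD oppr_eq0 (pnatr_eq0 _ 2). Qed.

Lemma stabilizer_generatorsS : stabilizer_generators R S.
Proof.
split=> [i j|[s]|j [s [sj]]].
- rewrite !HS.
  rewrite !mulmxA -(mulmxA _ (adj U) U) UU mulmx1 -[in RHS](mulmxA _ (adj U) U) UU mulmx1.
  rewrite -(mulmxA U) -[in RHS](mulmxA U) weylC /sympl /= dotb0 dot0b.
  by rewrite scale1r.
(* Pulled back by [U], every product of generators has diagonal entry 1 at the zero bit string. *)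
- have [z [-> _]] := stabilizer_prod s.
  have -> : (- 1%:M : 'M[C]_(dim n)) = U *m (- 1%:M) *m adj U.
    by rewrite mulmxN mulmx1 mulNmx UUc.
  move/conj_unitary_inj/matrixP/(_ (ket_idx 0) (ket_idx 0)).
  rewrite weyl_Z_diag ket_idxK dotb0 expr0 !mxE eqxx => e.
  exact: neq1N1 (esym e).
(* At the basis state with only bit [j] set, generator [j] has diagonal entry -1, and a product of
   the others has 1. *)
have [z [-> zs]] := stabilizer_prod s; rewrite HS.
move/conj_unitary_inj/matrixP.
move=> /(_ (ket_idx (ebit (lshift k j))) (ket_idx (ebit (lshift k j)))).
rewrite !weyl_Z_diag ket_idxK !dotb_ebit !ffunE eqxx.
rewrite (unsplitK (inl j)) zs; last by apply/negP => /(allP sj); rewrite eqxx.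
by rewrite expr1 expr0 => e; apply: neq1N1.
Qed.

Lemma encodingS : encoding S (U *m embed R m k).
Proof.
split.
  by rewrite adj_mulmx mulmxA -(mulmxA _ (adj U)) UU mulmx1 embed_isometry.
move=> psi; split=> [Hpsi|[phi ->] M [s ->]]; last first.
  have [z [-> _]] := stabilizer_prod s.
  rewrite -!mulmxA (mulmxA (adj U)) UU mul1mx; congr (U *m _).
  apply/matrixP => i j; rewrite weyl_mulmx /= addr0 bit_ofK !embed_mulmx.
  case: eqP => [i0|_]; last by rewrite mulr0.
  by rewrite dotb_split lowbK highbK i0 dotb0 dot0b mul1r.
pose y := adj U *m psi.
exists (adj (embed R m k) *m y).
(* The pulled-back state [y] is fixed by Z on each of the first [m] qubits. At a basis state where
   one of these bits is 1, its amplitude equals its own negative. *)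
suff Hy : embed R m k *m (adj (embed R m k) *m y) = y.
  by rewrite -mulmxA Hy /y mulmxA UUc mul1mx.
have Zy j : weyl R (ez (lshift k j)) *m y = y.
  have /Hpsi : in_group S (pauli_mx R (S j)) by exists [:: j]; rewrite big_seq1.
  rewrite HS => e; rewrite /y -[in RHS]e !mulmxA UU mul1mx.
  by [].
apply/matrixP => i j; rewrite embed_mulmx adj_embed_mulmx ket_idxK.
case: eqP => [i0|i0]; first by rewrite -i0 joinbK bit_ofK.
have [l il] : exists l, lowb (bit_of i) l.
  apply/existsP; rewrite -[X in is_true X]negbK negb_exists; apply/negP => /forallP H.
  by case: i0; apply/ffunP => l; rewrite [RHS]ffunE; apply/negbTE.
have := congr1 (fun M : 'cV[C]_(dim n) => M i j) (Zy l).
rewrite weyl_mulmx /= addr0 bit_ofK dotbC dotb_ebit.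
rewrite ffunE in il; rewrite il expr1 mulN1r => /eqP.
by rewrite eq_sym -subr_eq0 opprK -mulr2n mulrn_eq0 /= => /eqP.
Qed.

(** The decoder is the single Kraus operator undoing [U] and splitting the registers. The error then
    leaves the definite string [s0] in the syndrome register and one Pauli operator on [phi], so [A]
    is nonzero only at [s0]. *)
Lemma list_code_at_transvs (d : bits m -> 'I_L -> bits k * bits k) :
  (forall e : bits n * bits n, (#|[set i | e.1 i || e.2 i]| <= t)%N ->
     exists b, highv (transvs ws e) = subsum (d (lowb (transvs ws e).1)) b) ->
  list_code_at n m.
Proof.
move=> Hd; exists S; split; first exact: stabilizer_generatorsS.
exists (U *m embed R m k); split; first exact: encodingS.
exists 1%N, (fun=> unjoin R m k *m adj U); split.
  rewrite /trace_preserving big_ord1 adj_mulmx adj_adj mulmxA -(mulmxA U).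
  by rewrite unjoin_isometry mulmx1 UUc.
exists (fun s l => Pauli ord0 (d s l).1 (d s l).2) => E wE.
pose e := (pX E, pZ E); pose a := transvs ws e; pose s0 := lowb a.1.
have [b Hb] := Hd e wE.
exists 1%N, (fun s _ => if s == s0 then weyl R (highv a) else 0); split; last split.
- rewrite (bigD1 s0) //= [X in _ + X]big1 => [|s /negPf ->]; last first.
    by rewrite big_ord1 mulmx0.
  rewrite big_ord1 eqxx addr0 adj_weyl -scalemxAl weylM scalerA -signr_addb.
  by rewrite addv_self weyl0 dotbC addbb scale1r.
- move=> s _; case: eqP => [->|_]; last exact: in_list_span0.
  by rewrite [highv a]Hb; apply: weyl_in_list_span.
move=> phi _ psi; rewrite /apply_channel big_ord1.
rewrite (bigD1 s0) //= [X in _ + X]big1 => [|s /negPf ->]; last first.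
  by rewrite big_ord1 !mul0mx tens0mx.
rewrite big_ord1 eqxx addr0.
have [u Hu] := HU e.
have Kpsi : unjoin R m k *m adj U *m psi =
    (iu R ^+ pphase E * iu R ^+ u) *: (unjoin R m k *m (weyl R a *m (embed R m k *m phi))).
  rewrite /psi pauli_mxE -/e -scalemxAl mulmxA mulmxA Hu.
  rewrite -!scalemxAl -!scalemxAr scalerA; congr (_ *: _).
  by rewrite !mulmxA -(mulmxA _ (adj U) U) UU mulmx1.
have -> : unjoin R m k *m adj U *m (psi *m adj psi) *m adj (unjoin R m k *m adj U) =
   (unjoin R m k *m adj U *m psi) *m adj (unjoin R m k *m adj U *m psi).
  by rewrite (adj_mulmx _ psi) !mulmxA.
(* The phases of the error and of [HU] cancel between [psi] and its adjoint. *)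
rewrite {}Kpsi adj_scale -scalemxAl -scalemxAr scalerA.
rewrite -exprD phase_unit scale1r.
have -> : weyl R (highv a) *m (phi *m adj phi) *m adj (weyl R (highv a)) =
   (weyl R (highv a) *m phi) *m adj (weyl R (highv a) *m phi).
  by rewrite adj_mulmx !mulmxA.
apply/matrixP => i j; rewrite -{2}(mxtens_unindexK i) -{2}(mxtens_unindexK j).
case Ei: (mxtens_unindex i) => [i1 i2]; case Ej: (mxtens_unindex j) => [j1 j2].
rewrite tensmxE !outerE.
rewrite (unjoin_weyl_embed a phi i) (unjoin_weyl_embed a phi j) Ei Ej /=.
rewrite [proj_syn _ _ _ _]mxE conjcM conjc_nat !(can2_eq (@bit_ofK _) (@ket_idxK _)) -/s0.
by case: eqP => _; case: eqP => _; rewrite ?mul1r ?mul0r ?mulr1 ?mulr0.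
Qed.

End Code.

(** * The ball of low-weight errors and its volume *)

Definition vweight n (e : bits n * bits n) : nat := #|[set i | e.1 i || e.2 i]|.
Definition ball n t : {set bits n * bits n} := [set e | (vweight e <= t)%N].

(** For [k = 0] there is no logical part to list, so the counting bound is assumed only for positive
    [k]. *)
Lemma exists_list_code_at (R : realType) (m k t L : nat) : (0 < L)%N ->
  (0 < k -> 2 * #|ball (m + k) t| ^ L.+1 < 2 ^ (L * m))%N ->
  list_code_at R k t L (m + k) m.
Proof.
move=> L0 HB.
have [ws Hws] : exists ws, forall s : bits m, exists d : 'I_L -> bits k * bits k,
    forall e, e \in ball (m + k) t -> lowb (transvs ws e).1 = s ->
    exists b, highv (transvs ws e) = subsum d b.
  case: k HB => [|k] HB; last exact: exists_list_decodable (HB isT).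
  exists [::] => s; exists (fun=> 0) => e _ _; exists 0.
  by rewrite [LHS]surjective_pairing [RHS]surjective_pairing;
     congr (_, _); apply/ffunP => -[].
have [d Hd] := fin_all_exists Hws.
have [U UU HU] := transvs_unitary R ws.
have [S HS] := fin_all_exists (exists_conj_Z UU HU).
apply: (list_code_at_transvs UU HU HS (d := d)) => e et.
by apply: Hd => //; rewrite inE.
Qed.

Section Volume.
Variable R : realType.

(** The weight enumerator factors over the qubits: the identity contributes 1 and each of X, Y, Z
    contributes [x]. *)
Lemma sum_pow_vweight n (x : R) :
  \sum_(e : bits n * bits n) x ^+ vweight e = (1 + 3 * x) ^+ n.
Proof.
have vw e : x ^+ vweight e = \prod_(i < n) x ^+ (e.1 i || e.2 i).
  rewrite /vweight -sum1_card big_mkcond /=.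
  rewrite (big_morph (fun k => x ^+ k) (exprD x) (expr0 x)).
  by apply: eq_bigr => i _; rewrite inE; case: (_ || _).
under eq_bigr do rewrite vw.
rewrite -(pair_bigA _ (fun u v : bits n => \prod_(i < n) x ^+ (u i || v i))) /=.
under eq_bigr => u _ do
  rewrite -(bigA_distr_bigA (fun i (c : bool) => x ^+ (u i || c))).
rewrite -(bigA_distr_bigA (fun i (b : bool) => \sum_(c : bool) x ^+ (b || c))) /=.
rewrite prodr_const card_ord; congr (_ ^+ _).
by rewrite !big_bool /= expr1 expr0; ring.
Qed.

Lemma card_ball_gt0 n t : (0 : R) < #|ball n t|%:R.
Proof.
rewrite ltr0n; apply/card_gt0P; exists 0; rewrite inE /vweight.
by rewrite (eq_card (B := pred0)) ?card0 // => i; rewrite !inE !ffunE.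
Qed.

(** Chernoff's argument: since [x <= 1], each element of the ball contributes at least [x ^+ t] to
    the weight enumerator. *)
Lemma card_ball_le n t (x : R) : 0 < x <= 1 ->
  #|ball n t|%:R * x ^+ t <= (1 + 3 * x) ^+ n.
Proof.
move=> /andP[x0 x1]; rewrite -sum_pow_vweight.
rewrite (bigID (fun e => e \in ball n t)) /= -[leLHS]addr0; apply: lerD; last first.
  by apply: sumr_ge0 => e _; rewrite exprn_ge0 // ltW.
rewrite mulr_natl -sumr_const; apply: ler_sum => e; rewrite inE => et.
by apply: ler_wiXn2l; rewrite // ltW.
Qed.

Lemma ln_exprn n (x : R) : 0 < x -> ln (x ^+ n) = n%:R * ln x.
Proof. by move=> x0; rewrite lnXn // mulr_natl. Qed.

Lemma ln_card_ball n t (p : R) : 0 < p -> p <= 3 / 4 -> t%:R <= p * n%:R ->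
  ln (#|ball n t|%:R : R) <= n%:R * ((Hbin p + p * log2 3) * ln 2).
Proof.
move=> p0 p34 tpn.
have q0 : 0 < 1 - p by lra.
(* The minimizer of (1 + 3 x)^n / x^(p n); it is at most 1 exactly when [p <= 3 / 4]. *)
pose x := p / (3 * (1 - p)).
have x0 : 0 < x by rewrite divr_gt0 // mulr_gt0.
have x1 : x <= 1 by rewrite ler_pdivrMr ?mulr_gt0 //; lra.
have B0 := card_ball_gt0 n t.
have := @card_ball_le n t x; rewrite x0 x1 => /(_ isT).
have -> : 1 + 3 * x = (1 - p)^-1 by rewrite /x; field; lra.
rewrite -ler_ln ?posrE ?mulr_gt0 ?exprn_gt0 ?invr_gt0 //.
rewrite lnM ?posrE ?exprn_gt0 // !ln_exprn ?invr_gt0 // lnV ?posrE //.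
have lnx : ln x = ln p - ln 3 - ln (1 - p).
  by rewrite /x ln_div ?posrE ?mulr_gt0 // lnM ?posrE //; ring.
have lnx0 : ln x <= 0 by apply: ln_le0.
have ln2 : 0 < ln (2 : R) by apply: ln_gt0; rewrite ltr1n.
have -> : (Hbin p + p * log2 3) * ln 2 = - p * ln p - (1 - p) * ln (1 - p) + p * ln 3.
  by rewrite /Hbin /log2; field; rewrite lt0r_neq0.
move=> H.
have : p * n%:R * ln x <= t%:R * ln x by rewrite ler_wnM2r.
by move: H; rewrite lnx; move: (ln p) (ln (1 - p)) (ln 3) => a b c; lra.
Qed.

End Volume.

(** * Comparison of exponents for large block length *)

Theorem theorem1 (R : realType) (p : R) (L : nat) (Rate : R) :
  0 < p < 1 -> (1 <= L)%N ->
  Rate < 1 - (1 + (L%:R)^-1) * (Hbin p + p * log2 3) ->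
  exists N : nat, forall n : nat, (N <= n)%N ->
    list_code R n (Num.truncn (Rate * n%:R)) (Num.truncn (p * n%:R)) L.
Proof.
move=> /andP[p0 p1] L0 HR; set h := Hbin p + p * log2 3 in HR.
have ln2 : 0 < ln (2 : R) by apply: ln_gt0; rewrite ltr1n.
have Hbin0 : 0 <= Hbin p.
  have lp : ln p <= 0 by apply: ln_le0; lra.
  have lq : ln (1 - p) <= 0 by apply: ln_le0; lra.
  rewrite /Hbin /log2 !mulrA -mulrBl; apply: divr_ge0; last exact: ltW.
  by nra.
(* From 2^4 <= 3^3; it makes [p * log2 3] exceed 1 once [p > 3 / 4]. *)
have log23 : 4 / 3 <= log2 (3 : R).
  rewrite /log2 ler_pdivlMr //.
  have : ln ((2 : R) ^+ 4) <= ln (3 ^+ 3).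
    by rewrite ler_ln ?posrE ?exprn_gt0 // -!natrX ler_nat.
  rewrite !ln_exprn //; lra.
have L0' : (0 : R) < L%:R by rewrite ltr0n.
have LV0 : 0 < (L%:R : R)^-1 by rewrite invr_gt0.
have h0 : 0 <= h by rewrite /h; nra.
have R1 : Rate < 1 by nra.
(* The exponent gap per qubit between 2^(L (n - k)) and the bound on |B|^(L + 1). Beating the
   remaining factor 2 takes [1 < n%:R * delta]. *)
pose delta := L%:R * (1 - Rate) - (L%:R + 1) * h.
have delta0 : 0 < delta.
  have : L%:R * Rate < L%:R * (1 - (1 + L%:R^-1) * h) by rewrite ltr_pM2l.
  have -> : L%:R * (1 - (1 + L%:R^-1) * h) = L%:R - (L%:R + 1) * h.
    by field; rewrite lt0r_neq0.
  by rewrite /delta; lra.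
exists (Num.truncn delta^-1).+1 => n Nn.
have n_delta : 1 < n%:R * delta.
  have : delta^-1 < n%:R.
    by apply: lt_le_trans (truncnS_gt _) _; rewrite ler_nat.
  by rewrite -ltr_pdivrMr // div1r.
set k := Num.truncn _; set t := Num.truncn _.
(* For negative [Rate] the truncation is 0, so [k%:R <= Rate * n%:R] is claimed only for positive
   [k]. *)
have kR : (0 < k)%N -> k%:R <= Rate * n%:R /\ 0 < Rate.
  rewrite truncn_gt0 => R1n; split; last by have : (0 : R) <= n%:R by []; nra.
  by rewrite /k -truncn_ge_nat // (le_trans ler01).
have kn : (k <= n)%N.
  have [->//|k0] := posnP k; rewrite -(ler_nat R).
  have [kRn _] := kR k0; apply: le_trans kRn _.
  by have : (0 : R) <= n%:R by []; nra.
split=> //.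
have := @exists_list_code_at R (n - k) k t L L0; rewrite subnK //; apply => k0.
have [kRn Rate0] := kR k0.
(* A larger [p] would give [h > 1], and then the rate condition contradicts [Rate0]. *)
have p34 : p <= 3 / 4.
  rewrite leNgt; apply/negP => p34.
  have h1 : 1 < h by rewrite /h; nra.
  by nra.
have tn : t%:R <= p * n%:R.
  by rewrite /t -truncn_ge_nat // mulr_ge0 // ltW.
have := ln_card_ball p0 p34 tn; rewrite -/h.
have B0 := card_ball_gt0 R n t.
move=> lnB; rewrite -(ltr_nat R) natrM !natrX -ltr_ln ?posrE ?mulr_gt0 ?exprn_gt0 //.
rewrite lnM ?posrE ?exprn_gt0 // !ln_exprn // natrM natrB // -natr1.
have : (L%:R + 1) * ln #|ball n t|%:R <= (L%:R + 1) * (n%:R * (h * ln 2)).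
  by rewrite ler_pM2l ?ltr_wpDl.
have : L%:R * k%:R * ln 2 <= L%:R * (Rate * n%:R) * ln 2.
  by rewrite ler_pM2r // ler_pM2l.
have : 1 * ln 2 < n%:R * delta * ln 2 by rewrite ltr_pM2r.
by rewrite /delta; lra.
Qed.
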